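(* Let $\xi,\eta>0$ and $$\hat\mu_0=-\frac{i}{3}\,\xi\,\mathrm{diag}(2,-1,-1)-\frac{i}{3}\,\eta\,\mathrm{diag}(1,1,-2).$$ For $(z_1,z_2,z_3)\in\mathbb{C}^3$ let $\hat z$ be the lower triangular matrix $$\hat z=\begin{pmatrix}1&0&0\\ z_1&1&0\\ z_3&z_2&1\end{pmatrix},$$ let $\hat z=\hat n\hat a\hat u$ be its Iwasawa decomposition in $\mathrm{SL}(3,\mathbb{C})$ ($\hat n$ complex upper triangular with ones on the diagonal, $\hat a$ diagonal with positive real entries and determinant $1$, $\hat u\in\mathrm{SU}(3)$), and let $\hat\mu=\hat u^{*}\hat\mu_0\hat u$ be the corresponding point of the coadjoint orbit of $\mathrm{SU}(3)$ through $\hat\mu_0$. Put $$r_1^2=1+|z_1|^2+|z_3-z_1z_2|^2,\qquad r_2^2=1+|z_2|^2+|z_3|^2.$$ Then the group coordinates $\mu_1,\dots,\mu_8$ of $\hat\mu$ are $$\begin{aligned} \mu_1&=-\frac{\eta}{r_2^2}(\bar z_2z_3+z_2\bar z_3)-\frac{\xi}{r_1^2}(z_1+\bar z_1),\\ \mu_2&=\frac{i\eta}{r_2^2}(\bar z_2z_3-z_2\bar z_3)+\frac{i\xi}{r_1^2}(z_1-\bar z_1),\\ \mu_3&=\frac{\eta}{r_2^2}(|z_2|^2-|z_3|^2)+\frac{\xi}{r_1^2}(1-|z_1|^2),\\ \mu_4&=-\frac{\eta}{r_2^2}(z_3+\bar z_3)-\frac{\xi}{r_1^2}(z_3-z_1z_2+\bar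 z_3-\bar z_1\bar z_2),\\ \mu_5&=\frac{i\eta}{r_2^2}(z_3-\bar z_3)+\frac{i\xi}{r_1^2}\bigl(z_3-z_1z_2-(\bar z_3-\bar z_1\bar z_2)\bigr),\\ \mu_6&=-\frac{\eta}{r_2^2}(z_2+\bar z_2)+\frac{\xi}{r_1^2}\bigl(\bar z_1(z_3-z_1z_2)+z_1(\bar z_3-\bar z_1\bar z_2)\bigr),\\ \mu_7&=\frac{i\eta}{r_2^2}(z_2-\bar z_2)-\frac{i\xi}{r_1^2}\bigl(\bar z_1(z_3-z_1z_2)-z_1(\bar z_3-\bar z_1\bar z_2)\bigr),\\ \sqrt3\,\mu_8&=\frac{\eta}{r_2^2}(2-|z_2|^2-|z_3|^2)+\frac{\xi}{r_1^2}(1+|z_1|^2-2|z_3-z_1z_2|^2). \end{aligned}$$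
   Context: The dual space of $\mathfrak{su}(3)$ is identified with the traceless skew-Hermitian $3\times3$ matrices, and the coadjoint action is $\mathrm{Ad}^*_g\mu=g^{-1}\mu g$. The real group coordinates $\mu_1,\dots,\mu_8$ of a point $\hat\mu$ are defined by $$\hat\mu=-\frac{i}{2}\begin{pmatrix}\mu_3+\frac{1}{\sqrt3}\mu_8&\mu_1-i\mu_2&\mu_4-i\mu_5\\ \mu_1+i\mu_2&-\mu_3+\frac{1}{\sqrt3}\mu_8&\mu_6-i\mu_7\\ \mu_4+i\mu_5&\mu_6+i\mu_7&-\frac{2}{\sqrt3}\mu_8\end{pmatrix}.$$ The star denotes the Hermitian conjugate. This map from $(z_1,z_2,z_3)$ to the orbit is called the generalized stereographic projection onto a generic orbit of $\mathrm{SU}(3)$. *)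

(* Defs.v *)
From HB Require Import structures.
From mathcomp Require Import all_boot all_order all_algebra.
From mathcomp Require Import spectral sesquilinear complex reals.

Set Implicit Arguments.
Unset Strict Implicit.
Unset Printing Implicit Defensive.

Import Order.TTheory GRing.Theory Num.Theory.

(* ring_scope is opened last, so that z^* and 'i are the numClosedFieldType
   conjugation and imaginary unit of R[i]. *)
Local Open Scope complex_scope.
Local Open Scope sesquilinear_scope.
Local Open Scope ring_scope.

Definition mx3 (T : nzRingType) (rows : seq (seq T)) : 'M[T]_3 :=
  \matrix_(i < 3, j < 3) (nth [::] rows i)`_j.

Definition diag3 (T : nzRingType) (a b c : T) : 'M[T]_3 :=
  diag_mx (\row_(j < 3) [:: a; b; c]`_j).

Definition is_SU (R : realType) (k : nat) (u : 'M[R[i]]_k) : Prop :=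
  u \is unitarymx /\ \det u = 1.

(* In R[i], 0 < x says that x is real and positive. *)
Record is_iwasawa (R : realType) (k : nat) (g n a u : 'M[R[i]]_k) : Prop := {
  iwasawa_eq : g = n *m a *m u;
  iwasawa_n_upper : forall i j : 'I_k, (j < i)%N -> n i j = 0;
  iwasawa_n_diag : forall i, n i i = 1;
  iwasawa_a_diag : is_diag_mx a;
  iwasawa_a_pos : forall i, 0 < a i i;
  iwasawa_a_det : \det a = 1;
  iwasawa_u_SU : is_SU u
}.

(* Ad^*_u m = u^{-1} m u, with u^{-1} = u^* on SU(k). *)
Definition coadjoint (R : realType) (k : nat) (u m : 'M[R[i]]_k) : 'M[R[i]]_k :=
  u ^t* *m m *m u.

Record su3_coords (R : Type) := Su3Coords {
  mu1 : R; mu2 : R; mu3 : R; mu4 : R; mu5 : R; mu6 : R; mu7 : R; mu8 : R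
}.

Definition su3_mx (R : realType) (mu : su3_coords R) : 'M[R[i]]_3 :=
  let m1 := (mu1 mu)%:C in let m2 := (mu2 mu)%:C in
  let m3 := (mu3 mu)%:C in let m4 := (mu4 mu)%:C in
  let m5 := (mu5 mu)%:C in let m6 := (mu6 mu)%:C in
  let m7 := (mu7 mu)%:C in let m8 := (mu8 mu)%:C in
  let s3 := (Num.sqrt (3 : R))%:C in
  - ('i / 2) *: mx3
    [:: [:: m3 + 1 / s3 * m8; m1 - 'i * m2;         m4 - 'i * m5];
        [:: m1 + 'i * m2;     - m3 + 1 / s3 * m8;   m6 - 'i * m7];
        [:: m4 + 'i * m5;     m6 + 'i * m7;         - (2 / s3 * m8)]].

Definition is_group_coords (R : realType) (m : 'M[R[i]]_3) (mu : su3_coords R)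
  : Prop := m = su3_mx mu.

Definition base_point (R : realType) (xi eta : R) : 'M[R[i]]_3 :=
  - ('i / 3 * xi%:C) *: diag3 2 (-1) (-1)
  - ('i / 3 * eta%:C) *: diag3 1 1 (-2).

Definition lower_unipotent (R : realType) (z1 z2 z3 : R[i]) : 'M[R[i]]_3 :=
  mx3 [:: [:: 1;  0;  0];
          [:: z1; 1;  0];
          [:: z3; z2; 1]].

(* Main.v *)
Require Import Defs.
From HB Require Import structures.
From mathcomp Require Import all_boot all_order all_algebra.
From mathcomp Require Import spectral sesquilinear complex reals.
From mathcomp Require Import ring.

Set Implicit Arguments.
Unset Strict Implicit.
Unset Printing Implicit Defensive.

Import Order.TTheory GRing.Theory Num.Theory.
Local Open Scope complex_scope.
Local Open Scope sesquilinear_scope.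
Local Open Scope ring_scope.

(** Up to a multiple of the identity, the base point is a combination of two
    rank-one diagonal projections:
      mu_0 = - i xi E_00 + i eta E_22 + (i/3) (xi - eta) 1,
    and a unitary u turns E_ii into the orthogonal projection onto the line
    spanned by the adjoint of its i-th row. So only the lines of the first
    and last rows of u are needed, and both can be read off z = n a u without
    computing the decomposition. Since n a is upper triangular, the last row
    of z is a multiple of the last row of u. Dually, if w is the column with
    z w = e_0, then (n a) (u w) = e_0, back substitution makes u w a multiple
    of e_0, and the adjoint of w is a multiple of the first row of u
    ([iwasawa_row_lines]). A projection onto a line is determined by any
    nonzero vector on it ([unitary_conj_delta]); the squared norms of the two
    vectors found here are r_1^2 and r_2^2, which yields the entries of the
    orbit point ([coadjoint_stereographic]).

    The group coordinates are linear functions of the matrix entries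
    ([group_coordsE]), which gives their uniqueness; they are real because the
    coadjoint action preserves skew-Hermitian traceless matrices
    ([group_coords_exists]). *)

(** * Triangular matrices and unitary projections *)

Lemma adjmxZ (C : numClosedFieldType) (p q : nat) (c : C) (A : 'M[C]_(p, q)) :
  (c *: A) ^t* = c^* *: A ^t*.
Proof. by apply/matrixP=> i j; rewrite !mxE rmorphM. Qed.

Definition upper_triangular (F : nzRingType) (k : nat) (T : 'M[F]_k) : Prop :=
  forall i j : 'I_k, (j < i)%N -> T i j = 0.

Lemma row_last_mul (F : nzRingType) (k p : nat) (T : 'M[F]_k.+1)
    (A : 'M[F]_(k.+1, p)) :
  upper_triangular T ->
  row ord_max (T *m A) = T ord_max ord_max *: row ord_max A.
Proof.
move=> T_upper; apply/rowP=> j; rewrite !mxE (bigD1 ord_max) //=.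
rewrite big1 ?addr0 // => i i_neq_max.
by rewrite T_upper ?mul0r // ltn_neqAle i_neq_max -ltnS ltn_ord.
Qed.

(** Back substitution: the last nonzero entry of [c] is multiplied by a nonzero
    diagonal entry of [T], so it survives in [T *m c] and must be the first. *)
Lemma upper_triangular_back_subst (F : fieldType) (k : nat) (T : 'M[F]_k.+1)
    (c : 'cV[F]_k.+1) :
  upper_triangular T -> (forall i, T i i != 0) ->
  T *m c = delta_mx 0 0 -> c = c 0 0 *: delta_mx 0 0.
Proof.
move=> T_upper T_diag Tc; apply/colP=> i; rewrite !mxE eqxx andbT.
case: eqVneq => [->|i_neq0]; first by rewrite mulr1.
rewrite mulr0; apply/eqP/negP=> /negP ci_neq0.
(* m is the last index of a nonzero entry of c, sought among those other
   than 0. *)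
have [m /andP[m_neq0 cm_neq0] m_max] :=
  @arg_maxnP _ i (fun j => (j != 0) && (c j 0 != 0)) (@nat_of_ord _)
    (introT andP (conj i_neq0 ci_neq0)).
have := congr1 (fun x : 'cV_k.+1 => x m 0) Tc.
rewrite !mxE (negPf m_neq0) (bigD1 m) //= big1 ?addr0 => [/eqP|j j_neq_m].
  by rewrite mulf_eq0 (negPf (T_diag m)) (negPf cm_neq0).
have [j_lt_m|m_le_j] := ltnP j m; first by rewrite T_upper ?mul0r.
have [->|cj_neq0] := eqVneq (c j 0) 0; first by rewrite mulr0.
have j_neq0 : j != 0.
  apply: contraNneq m_neq0 => j0; rewrite -val_eqE -leqn0.
  by rewrite -[0%N]/(val (0 : 'I_k.+1)) -j0.
have j_le_m : (j <= m)%N by apply: m_max; rewrite j_neq0.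
by case/eqP: j_neq_m; apply/val_inj/anti_leq; rewrite j_le_m.
Qed.

(** Both sides are the orthogonal projection onto the line spanned by the
    adjoint of row [i] of [u]: that row is a unit vector, and the normalized
    outer product of [t] does not depend on the factor [c]. *)
Lemma unitary_conj_delta (C : numClosedFieldType) (k : nat) (u : 'M[C]_k)
    (i : 'I_k) (t : 'rV[C]_k) (c : C) :
  u \is unitarymx -> t != 0 -> t = c *: row i u ->
  u ^t* *m delta_mx i i *m u = ((t *m t ^t*) 0 0)^-1 *: (t ^t* *m t).
Proof.
move=> /unitarymxP u_unitary t_neq0 t_row.
have c_neq0 : c != 0.
  by apply: contraNneq t_neq0 => c0; rewrite t_row c0 scale0r.
have -> : t *m t ^t* = (c * c^*)%:M.
  have ri : row i u *m (row i u) ^t* = 1%:M.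
    rewrite rowE trmx_mul map_mxM -mulmxA (mulmxA u) u_unitary mul1mx.
    apply/matrixP=> a b; rewrite !ord1 !mxE (bigD1 i) //= big1.
      by rewrite !mxE !eqxx conjC1 mulr1 addr0.
    by move=> j /negPf j_neq; rewrite !mxE j_neq mul0r.
  rewrite t_row adjmxZ -scalemxAl -scalemxAr ri.
  by rewrite scalerA scalemx1.
rewrite mxE eqxx mulr1n t_row adjmxZ -scalemxAl -scalemxAr !scalerA.
rewrite -mulrA [c^* * c]mulrC mulVf ?mulf_neq0 ?conjC_eq0 // scale1r.
rewrite rowE trmx_mul map_mxM trmx_delta map_delta_mx mulmxA.
by rewrite -(mulmxA _ (delta_mx i 0)) mul_delta_mx.
Qed.

(** * The base point and its orbit *)

(** This follows from diag(2, -1, -1) = 3 E_00 - 1 and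
    diag(1, 1, -2) = 1 - 3 E_22. *)
Lemma base_point_delta (R : realType) (xi eta : R) :
  base_point xi eta =
    - ('i * xi%:C) *: delta_mx 0 0 + ('i * eta%:C) *: delta_mx 2 2
    + ('i / 3 * (xi%:C - eta%:C))%:M.
Proof.
by apply/matrixP=> -[[|[|[|//]]] ?] [[|[|[|//]]] ?]; rewrite !mxE /=; field.
Qed.

Lemma conj_real_complex (R : realType) (x : R) : (x%:C)^* = x%:C :> R[i].
Proof. exact: conjc_real. Qed.

Lemma base_point_skew (R : realType) (xi eta : R) :
  (base_point xi eta) ^t* = - base_point xi eta.
Proof.
rewrite base_point_delta; apply/matrixP=> j k; rewrite !mxE.
rewrite [k == j]eq_sym ![(k == _) && _]andbC.
rewrite !rmorphD /= rmorphMn /= !rmorphM rmorphN !rmorphM /= fmorphV rmorphB /=.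
rewrite !rmorph_nat conjCi !conj_real_complex; ring.
Qed.

Lemma base_point_trace (R : realType) (xi eta : R) : \tr (base_point xi eta) = 0.
Proof. by rewrite /mxtrace !big_ord_recl big_ord0 !mxE /=; field. Qed.

Lemma coadjoint_skew (R : realType) (k : nat) (u m : 'M[R[i]]_k) :
  m ^t* = - m -> (coadjoint u m) ^t* = - coadjoint u m.
Proof.
move=> m_skew; rewrite /coadjoint 2!trmx_mul 2!map_mxM m_skew trmxCK.
by rewrite mulNmx mulmxN mulmxA.
Qed.

Lemma coadjoint_trace (R : realType) (k : nat) (u m : 'M[R[i]]_k) :
  u \is unitarymx -> \tr (coadjoint u m) = \tr m.
Proof.
by move=> /unitarymxP u_unitary; rewrite mxtrace_mulC mulmxA u_unitary mul1mx.
Qed.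

Lemma coadjoint_base_point (R : realType) (xi eta : R) (u : 'M[R[i]]_3) :
  u \is unitarymx ->
  coadjoint u (base_point xi eta) =
    - ('i * xi%:C) *: (u ^t* *m delta_mx 0 0 *m u)
    + ('i * eta%:C) *: (u ^t* *m delta_mx 2 2 *m u)
    + ('i / 3 * (xi%:C - eta%:C))%:M.
Proof.
move=> u_unitary; rewrite /coadjoint base_point_delta !mulmxDr !mulmxDl.
rewrite -!scalemxAr -!scalemxAl scalar_mxC -[_%:M *m _ *m u]mulmxA.
by rewrite -invmx_unitary // mulVmx ?unitarymx_unit // mulmx1.
Qed.

(** * Rows of the unitary Iwasawa factor *)

(** The first vector is the adjoint of the column [w] solving
    [lower_unipotent z1 z2 z3 *m w = delta_mx 0 0], that is, of the first
    column of the inverse matrix; the second is the last row of the matrix. *)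
Lemma iwasawa_row_lines (R : realType) (z1 z2 z3 : R[i]) (n a u : 'M[R[i]]_3) :
  is_iwasawa (lower_unipotent z1 z2 z3) n a u ->
  exists c d : R[i],
    \row_j [:: 1; - z1^*; (z1 * z2 - z3)^*]`_j = c *: row 0 u /\
    \row_j [:: z3; z2; 1]`_j = d *: row 2 u.
Proof.
case=> z_eq n_upper n_diag /is_diag_mxP a_diag a_pos _ [u_unitary _].
have naE i j : (n *m a) i j = n i j * a j j.
  rewrite mxE (bigD1 j) //= big1 ?addr0 // => l l_neq_j.
  by rewrite a_diag ?mulr0.
have na_upper : upper_triangular (n *m a).
  by move=> i j lt_ji; rewrite naE n_upper ?mul0r.
have na_diag i : (n *m a) i i != 0.
  by rewrite naE n_diag mul1r gt_eqF.
pose w : 'cV[R[i]]_3 := \col_j [:: 1; - z1; z1 * z2 - z3]`_j.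
have zw : lower_unipotent z1 z2 z3 *m w = delta_mx 0 0.
  apply/colP=> -[[|[|[|//]]] ?];
    by rewrite !mxE !big_ord_recl big_ord0 !mxE /=; ring.
exists ((u *m w) 0 0)^*, ((n *m a) 2 2); split.
  have uw : u *m w = (u *m w) 0 0 *: delta_mx 0 0.
    apply: (upper_triangular_back_subst na_upper na_diag).
    by rewrite mulmxA -z_eq.
  have -> : \row_j [:: 1; - z1^*; (z1 * z2 - z3)^*]`_j = w ^t*.
    by apply/rowP=> -[[|[|[|//]]] ?]; rewrite !mxE //= ?rmorph1 ?rmorphN.
  have -> : w ^t* = (u ^t* *m (u *m w)) ^t*.
    by rewrite mulmxA -invmx_unitary // mulVmx ?unitarymx_unit // mul1mx.
  rewrite {1}uw -scalemxAr adjmxZ trmx_mul map_mxM trmx_delta map_delta_mx.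
  by rewrite trmxCK -rowE.
have -> : \row_j [:: z3; z2; 1]`_j = row 2 (lower_unipotent z1 z2 z3).
  by apply/rowP=> j; rewrite !mxE.
have -> : 2 = ord_max :> 'I_3 by apply: val_inj.
by rewrite z_eq row_last_mul.
Qed.

(** Each rank-one projection of [coadjoint_base_point] becomes the outer product
    of the explicit vector on its line, divided by its squared norm. *)
Lemma coadjoint_stereographic (R : realType) (xi eta : R) (z1 z2 z3 : R[i])
    (n a u : 'M[R[i]]_3) :
  is_iwasawa (lower_unipotent z1 z2 z3) n a u ->
  let s : 'rV[R[i]]_3 := \row_j [:: 1; - z1^*; (z1 * z2 - z3)^*]`_j in
  let t : 'rV[R[i]]_3 := \row_j [:: z3; z2; 1]`_j in
  let r1sq : R[i] := 1 + `|z1| ^+ 2 + `|z3 - z1 * z2| ^+ 2 in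
  let r2sq : R[i] := 1 + `|z2| ^+ 2 + `|z3| ^+ 2 in
  forall j k, coadjoint u (base_point xi eta) j k =
    - 'i * (xi%:C / r1sq) * ((s 0 j)^* * s 0 k)
    + 'i * (eta%:C / r2sq) * ((t 0 j)^* * t 0 k)
    + ('i / 3 * (xi%:C - eta%:C)) *+ (j == k).
Proof.
move=> iwa s t r1sq r2sq j k.
have u_unitary : u \is unitarymx by case: iwa => _ _ _ _ _ _ [].
have [c [d [s_row t_row]]] := iwasawa_row_lines iwa.
have s_neq0 : s != 0.
  by apply/eqP=> /rowP/(_ 0)/eqP; rewrite !mxE /= oner_eq0.
have t_neq0 : t != 0.
  by apply/eqP=> /rowP/(_ 2)/eqP; rewrite !mxE /= oner_eq0.
have s_norm : (s *m s ^t*) 0 0 = r1sq.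
  rewrite mxE !big_ord_recl big_ord0 !mxE /= /r1sq !normCK.
  by rewrite !(rmorphB, rmorphM, rmorphN, rmorph1) /= !conjCK; ring.
have t_norm : (t *m t ^t*) 0 0 = r2sq.
  rewrite mxE !big_ord_recl big_ord0 !mxE /= /r2sq !normCK.
  by rewrite rmorph1; ring.
rewrite coadjoint_base_point // (unitary_conj_delta u_unitary s_neq0 s_row).
rewrite (unitary_conj_delta u_unitary t_neq0 t_row) s_norm t_norm.
(* The entries of s and t are from here on atoms of a ring identity. *)
clearbody s t r1sq r2sq.
rewrite !mxE !big_ord1 !mxE; ring.
Qed.

(** * Group coordinates *)

(** The entries are given at the numerals 0, 1, 2 of ['I_3], so that case
    analysis on indices leaves the same atoms as in [group_coordsE]. *)
Lemma mx3_eta (T : nzRingType) (m : 'M[T]_3) :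
  m = mx3 [:: [:: m 0 0; m 0 1; m 0 2];
              [:: m 1 0; m 1 1; m 1 2];
              [:: m 2 0; m 2 1; m 2 2]].
Proof.
by apply/matrixP=> -[[|[|[|//]]] ?] [[|[|[|//]]] ?]; rewrite !mxE /=;
  congr (m _ _); apply: val_inj.
Qed.

Lemma sqrt3_neq0 (R : realType) : (Num.sqrt (3 : R))%:C != 0.
Proof. by rewrite (inj_eq (@complexI _)) sqrtr_eq0 -ltNge ltr0n. Qed.

Lemma sqr_sqrt3 (R : realType) : (Num.sqrt (3 : R))%:C ^+ 2 = 3.
Proof. by rewrite -rmorphXn /= sqr_sqrtr ?ler0n // rmorph_nat. Qed.

Lemma group_coordsE (R : realType) (m : 'M[R[i]]_3) (mu : su3_coords R) :
  is_group_coords m mu ->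
    (mu1 mu)%:C = 'i * (m 0 1 + m 1 0) /\
    (mu2 mu)%:C = m 1 0 - m 0 1 /\
    (mu3 mu)%:C = 'i * (m 0 0 - m 1 1) /\
    (mu4 mu)%:C = 'i * (m 0 2 + m 2 0) /\
    (mu5 mu)%:C = m 2 0 - m 0 2 /\
    (mu6 mu)%:C = 'i * (m 1 2 + m 2 1) /\
    (mu7 mu)%:C = m 2 1 - m 1 2 /\
    (Num.sqrt 3 * mu8 mu)%:C = - 3 * 'i * m 2 2.
Proof.
have i2 : 'i ^+ 2 = -1 :> R[i] := sqrCi _.
have s3K := sqr_sqrt3 R.
move=> ->; do !split; rewrite !mxE ?rmorphM /=; field: i2 s3K => //;
  exact: sqrt3_neq0.
Qed.

Lemma su3_mx_inj (R : realType) : injective (@su3_mx R).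
Proof.
move=> mu mu' eq_mx.
have [e1 [e2 [e3 [e4 [e5 [e6 [e7 e8]]]]]]] := group_coordsE (erefl (su3_mx mu)).
have := group_coordsE (eq_mx : is_group_coords (su3_mx mu) mu').
rewrite -{}e1 -{}e2 -{}e3 -{}e4 -{}e5 -{}e6 -{}e7 -{}e8.
have s3_neq0 : Num.sqrt (3 : R) != 0 by rewrite sqrtr_eq0 -ltNge ltr0n.
case: mu mu' {eq_mx} => [a1 a2 a3 a4 a5 a6 a7 a8] [b1 b2 b3 b4 b5 b6 b7 b8] /=.
do 7 ![case=> /complexI <-].
by move=> /complexI /(mulfI s3_neq0) <-.
Qed.

(** Skew-Hermitian symmetry makes each right-hand side of [group_coordsE]
    real, so that it equals its real part; as the trace vanishes, the three
    diagonal entries are recovered from the two coordinates mu_3 and mu_8. *)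
Lemma group_coords_exists (R : realType) (m : 'M[R[i]]_3) :
  m ^t* = - m -> \tr m = 0 -> exists mu, is_group_coords m mu.
Proof.
move=> m_skew m_tr.
have i2 : 'i ^+ 2 = -1 :> R[i] := sqrCi _.
have s3K := sqr_sqrt3 R.
have s3_neq0 := sqrt3_neq0 R.
have mC i j : (m i j)^* = - m j i.
  by have := congr1 (fun x : 'M_3 => x j i) m_skew; rewrite !mxE.
have ReK (x : R[i]) : x^* = x -> (complex.Re x)%:C = x.
  by move/CrealP/RRe_real.
have m22 : m 2 2 = - m 0 0 - m 1 1.
  have : m 0 0 + (m 1 1 + m 2 2) = 0.
    rewrite -[RHS]m_tr /mxtrace !big_ord_recl big_ord0 addr0.
    by congr (m _ _ + (m _ _ + m _ _)); apply: val_inj.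
  by move=> tr0; apply/eqP; rewrite -subr_eq0 -tr0; apply/eqP; ring.
pose mu := Su3Coords
  (complex.Re ('i * (m 0 1 + m 1 0))) (complex.Re (m 1 0 - m 0 1))
  (complex.Re ('i * (m 0 0 - m 1 1)))
  (complex.Re ('i * (m 0 2 + m 2 0))) (complex.Re (m 2 0 - m 0 2))
  (complex.Re ('i * (m 1 2 + m 2 1))) (complex.Re (m 2 1 - m 1 2))
  (complex.Re (- 3 * 'i * m 2 2 / (Num.sqrt 3)%:C)).
have e1 : (mu1 mu)%:C = 'i * (m 0 1 + m 1 0).
  by apply: ReK; rewrite rmorphM rmorphD /= conjCi !mC; ring.
have e2 : (mu2 mu)%:C = m 1 0 - m 0 1.
  by apply: ReK; rewrite rmorphB /= !mC; ring.
have e3 : (mu3 mu)%:C = 'i * (m 0 0 - m 1 1).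
  by apply: ReK; rewrite rmorphM rmorphB /= conjCi !mC; ring.
have e4 : (mu4 mu)%:C = 'i * (m 0 2 + m 2 0).
  by apply: ReK; rewrite rmorphM rmorphD /= conjCi !mC; ring.
have e5 : (mu5 mu)%:C = m 2 0 - m 0 2.
  by apply: ReK; rewrite rmorphB /= !mC; ring.
have e6 : (mu6 mu)%:C = 'i * (m 1 2 + m 2 1).
  by apply: ReK; rewrite rmorphM rmorphD /= conjCi !mC; ring.
have e7 : (mu7 mu)%:C = m 2 1 - m 1 2.
  by apply: ReK; rewrite rmorphB /= !mC; ring.
have e8 : (mu8 mu)%:C = - 3 * 'i * m 2 2 / (Num.sqrt 3)%:C.
  apply: ReK; rewrite fmorph_div !rmorphM rmorphN rmorph_nat /= conjCi mC.
  by rewrite conj_real_complex; field.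
exists mu.
rewrite /is_group_coords [m in LHS]mx3_eta /su3_mx e1 e2 e3 e4 e5 e6 e7 e8.
apply/matrixP=> -[[|[|[|//]]] ?] [[|[|[|//]]] ?]; rewrite !mxE /=.
all: field: i2 s3K m22 => //.
Qed.

(** * The coordinates of the orbit point *)

Theorem mainTheorem1 (R : realType) (xi eta : R) (z1 z2 z3 : R[i])
    (n a u : 'M[R[i]]_3) :
  0 < xi -> 0 < eta ->
  is_iwasawa (lower_unipotent z1 z2 z3) n a u ->
  let r1sq : R[i] := 1 + `|z1| ^+ 2 + `|z3 - z1 * z2| ^+ 2 in
  let r2sq : R[i] := 1 + `|z2| ^+ 2 + `|z3| ^+ 2 in
  let X : R[i] := xi%:C / r1sq in
  let E : R[i] := eta%:C / r2sq in
  exists mu : su3_coords R,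
    unique (is_group_coords (coadjoint u (base_point xi eta))) mu /\
    (mu1 mu)%:C = - (E * (z2^* * z3 + z2 * z3^*)) - X * (z1 + z1^*) /\
    (mu2 mu)%:C = 'i * E * (z2^* * z3 - z2 * z3^*) + 'i * X * (z1 - z1^*) /\
    (mu3 mu)%:C = E * (`|z2| ^+ 2 - `|z3| ^+ 2) + X * (1 - `|z1| ^+ 2) /\
    (mu4 mu)%:C = - (E * (z3 + z3^*))
                  - X * (z3 - z1 * z2 + z3^* - z1^* * z2^*) /\
    (mu5 mu)%:C = 'i * E * (z3 - z3^*)
                  + 'i * X * (z3 - z1 * z2 - (z3^* - z1^* * z2^*)) /\
    (mu6 mu)%:C = - (E * (z2 + z2^*))
                  + X * (z1^* * (z3 - z1 * z2) + z1 * (z3^* - z1^* * z2^*)) /\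
    (mu7 mu)%:C = 'i * E * (z2 - z2^*)
                  - 'i * X * (z1^* * (z3 - z1 * z2)
                              - z1 * (z3^* - z1^* * z2^*)) /\
    (Num.sqrt 3 * mu8 mu)%:C =
      E * (2 - `|z2| ^+ 2 - `|z3| ^+ 2)
      + X * (1 + `|z1| ^+ 2 - 2 * `|z3 - z1 * z2| ^+ 2).
Proof.
move=> _ _ iwa r1sq r2sq X E.
have u_unitary : u \is unitarymx by case: iwa => _ _ _ _ _ _ [].
have [mu mu_coords] :
    exists mu, is_group_coords (coadjoint u (base_point xi eta)) mu.
  apply: group_coords_exists.
    exact/coadjoint_skew/base_point_skew.
  by rewrite coadjoint_trace // base_point_trace.
exists mu; split.
  split=> // mu' mu'_coords; apply: su3_mx_inj.
  by rewrite -mu_coords -mu'_coords.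
have := group_coordsE mu_coords.
rewrite !(coadjoint_stereographic _ _ iwa) -/r1sq -/r2sq -/X -/E !mxE /=.
have i2 : 'i ^+ 2 = -1 :> R[i] := sqrCi _.
have xiE : xi%:C = X * r1sq.
  by rewrite divfK // gt_eqF // /r1sq -addrA ltr_pwDl ?addr_ge0 ?exprn_ge0.
have etaE : eta%:C = E * r2sq.
  by rewrite divfK // gt_eqF // /r2sq -addrA ltr_pwDl ?addr_ge0 ?exprn_ge0.
(* Writing xi and eta as multiples of X and E makes all eight identities
   polynomial. *)
clearbody X E.
rewrite xiE etaE /r1sq /r2sq !normCK.
rewrite !(rmorphB, rmorphM, rmorphN, rmorph1, rmorph0) /=.
rewrite ?conjCK.
case=> -> [-> [-> [-> [-> [-> [-> ->]]]]]].
do !split.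
all: field: i2 => //.
Qed.
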